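(* Let $\mathcal{H}$ and $\mathcal{G}$ be real Hilbert spaces, let $L\colon\mathcal{H}\to\mathcal{G}$ be a nonzero bounded linear operator, let $B\colon\mathcal{G}\to 2^{\mathcal{G}}$ be a set-valued operator, let $\gamma\in(0,+\infty)$, let $\alpha\in[-1/\gamma,+\infty)$, and set $\beta=(\alpha+\gamma^{-1})\|L\|^{-2}-\gamma^{-1}$. Suppose that $B-\alpha\,\mathrm{Id}_{\mathcal{G}}$ is monotone. Then $(L\overset{\gamma}{\diamond}B)-\beta\,\mathrm{Id}_{\mathcal{H}}$ is monotone.
   Context: A set-valued operator $A\colon\mathcal{H}\to2^{\mathcal{H}}$ is monotone if $\langle x_1-x_2\mid x_1^*-x_2^*\rangle\geq 0$ whenever $x_1^*\in Ax_1$ and $x_2^*\in Ax_2$. $A^{-1}$ is defined by $x\in A^{-1}x^*\Leftrightarrow x^*\in Ax$. Sums, scalar multiples and compositions are pointwise, e.g. $(L^*\circ C\circ L)x=\{L^*y\mid y\in C(Lx)\}$. For a bounded linear $L\colon\mathcal{H}\to\mathcal{G}$ with adjoint $L^*$ and $C\colon\mathcal{G}\to2^{\mathcal{G}}$, the parallel composition is $L^*\triangleright C=(L^*\circ C^{-1}\circ L)^{-1}\colon\mathcal{H}\to2^{\mathcal{H}}$. For $\gamma>0$, the resolvent composition is $L\overset{\gamma}{\diamond}C=L^*\triangleright(C+\gamma^{-1}\mathrm{Id}_{\mathcal{G}})-\gamma^{-1}\mathrm{Id}_{\mathcal{H}}\colon\mathcal{H}\to2^{\mathcal{H}}$. *)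

(* Defs.v *)
From HB Require Import structures.
From mathcomp Require Import all_boot all_order all_algebra.
From mathcomp Require Import all_classical all_reals all_analysis.
From mathcomp Require Import ring lra.

Set Implicit Arguments.
Unset Strict Implicit.
Unset Printing Implicit Defensive.

Import Order.TTheory GRing.Theory Num.Theory.
Import numFieldNormedType.Exports.

Local Open Scope classical_set_scope.
Local Open Scope ring_scope.

(* A real Hilbert space is a complete normed space whose norm is induced by an
   inner product; [{dot T for idfun}] is the type of symmetric positive definite
   bilinear forms on [T]. *)
HB.mixin Record NormedModule_isInner (R : realType) (T : Type)
    of NormedModule R T := {
  inner : {dot T for idfun : R -> R};
  inner_norm : forall x : T, inner x x = `|x| ^+ 2
}.

#[short(type="hilbertType")]
HB.structure Definition Hilbert (R : realType) :=
  {T of CompleteNormedModule R T & NormedModule_isInner R T}.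

Section inner_theory.
Context {R : realType} {H : hilbertType R}.
Implicit Types x y z : H.

Lemma innerC x y : inner x y = inner y x.
Proof. by rewrite (hermC (@inner R H)) /= expr0 mul1r. Qed.

Lemma innerDl x y z : inner (x + y) z = inner x z + inner y z.
Proof. exact: linearDl. Qed.

Lemma innerZl (a : R) x z : inner (a *: x) z = a * inner x z.
Proof. exact: (linearZl_LR (@inner R H)). Qed.

Lemma innerBl x y z : inner (x - y) z = inner x z - inner y z.
Proof. exact: linearBl. Qed.

Lemma innerDr x y z : inner z (x + y) = inner z x + inner z y.
Proof. by rewrite !(innerC z) innerDl. Qed.

Lemma innerZr (a : R) x z : inner z (a *: x) = a * inner z x.
Proof. by rewrite !(innerC z) innerZl. Qed.

Lemma innerBr x y z : inner z (x - y) = inner z x - inner z y.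
Proof. by rewrite !(innerC z) innerBl. Qed.

Lemma normDZ_sqr x y (t : R) :
  `|x + t *: y| ^+ 2 = `|x| ^+ 2 + 2 * t * inner x y + t ^+ 2 * `|y| ^+ 2.
Proof.
rewrite -!inner_norm innerDl !innerDr !innerZl !innerZr (innerC y x); ring.
Qed.

Lemma cauchy_schwarz x y : `|inner x y| <= `|x| * `|y|.
Proof.
have [->|y0] := eqVneq y 0.
  by rewrite innerC -(scale0r 0) innerZl mul0r normr0 scale0r normr0 mulr0.
have ny : 0 < `|y| ^+ 2 by rewrite exprn_gt0// normr_gt0.
have : 0 <= `|x + (- (inner x y / `|y| ^+ 2)) *: y| ^+ 2 by rewrite exprn_ge0.
rewrite normDZ_sqr.
have -> : `|x| ^+ 2 + 2 * - (inner x y / `|y| ^+ 2) * inner x y +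
    (- (inner x y / `|y| ^+ 2)) ^+ 2 * `|y| ^+ 2 =
    (`|x| ^+ 2 * `|y| ^+ 2 - inner x y ^+ 2) / `|y| ^+ 2.
  by field; rewrite normr_eq0.
rewrite pmulr_lge0 ?invr_gt0// subr_ge0 -exprMn -(real_normK (num_real (inner x y))).
by rewrite ler_sqr ?nnegrE// mulr_ge0.
Qed.

(* Riesz representation theorem. *)
Lemma riesz (f : {linear H -> R^o}) : bounded_near f (nbhs (0 : H)) ->
  exists y, forall x, f x = inner x y.
Proof.
move=> /linear_boundedP /pinfty_ex_gt0[C C0 fC].
pose J x : R := `|x| ^+ 2 - 2 * f x.
have Jge x : - C ^+ 2 <= J x.
  rewrite /J; have := fC x; rewrite ler_norml => /andP[_ fx].
  have := sqr_ge0 (`|x| - C); nra.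
pose d := inf (range J).
have hJ : has_inf (range J).
  split; first by exists (J 0), 0.
  by exists (- C ^+ 2) => _ [x _ <-].
have dJ x : d <= J x by apply: ge_inf; [case: hJ|exists x].
have Jd e : 0 < e -> exists x, J x < d + e.
  by move=> e0; have [_ [x _ <-] Jx] := inf_adherent e0 hJ; exists x.
have JD x y (t : R) :
    J (x + t *: y) = J x + 2 * t * (inner x y - f y) + t ^+ 2 * `|y| ^+ 2.
  have fD : f (x + t *: y) = f x + t * f y :> R by rewrite linearD linearZ.
  by rewrite /J normDZ_sqr fD; move: (f x : R) (f y : R) => a b; ring.
have Jxy x y e : J x < d + e -> J y < d + e -> `|x - y| ^+ 2 <= 4 * e.
  move=> Jx Jy.
  have := dJ (x + 2^-1 *: (y - x)).
  have : y = x + 1 *: (y - x) by rewrite scale1r addrC subrK.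
  move=> /(congr1 J); rewrite !JD distrC; lra.
pose S (e : R) := [set x | J x < d + e].
pose F := filter_from [set e : R | 0 < e] S.
have FF : ProperFilter F.
  apply: filter_from_proper.
    apply: filter_from_filter; first by exists 1 => /=.
    move=> i j /= i0 j0; exists (Num.min i j); first by rewrite /= lt_min i0.
    move=> x; rewrite /S /= => Jx; split; apply: (lt_le_trans Jx);
      by rewrite lerD2l ge_min lexx ?orbT.
  by move=> e /= /Jd.
have Fc : cauchy F.
  apply: cauchy_exP => e e0 /=.
  have e20 : 0 < e ^+ 2 / 8 by rewrite divr_gt0// exprn_gt0.
  have [x Jx] := Jd _ e20; exists x; exists (e ^+ 2 / 8) => //= y Jy.
  rewrite -ball_normE /=.
  have h := Jxy _ _ _ Jx Jy.
  rewrite -(@ltr_pXn2r _ 2) ?nnegrE ?(ltW e0)//.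
  by apply: (le_lt_trans h); have := exprn_gt0 2 e0; lra.
have /cvg_ex[/= y Fy] : cvg F by exact: cauchy_cvg.
have Hy e : 0 < e -> exists2 x, J x < d + e & `|y - x| < e.
  move=> e0.
  have F1 : F (S e) by exists e.
  have F2 : F (ball y e) by apply: Fy; exact: nbhsx_ballx.
  have [x [Jx]] := filter_ex (filterI F1 F2).
  by rewrite -ball_normE /= => yx; exists x.
have key t x : 0 <= 2 * t * (inner y x - f x) + t ^+ 2 * `|x| ^+ 2.
  apply/ler_addgt0Pr => e e0.
  pose K := 1 + 2 * `|t| * `|x|.
  have K0 : 0 < K.
    by rewrite /K; have := mulr_ge0 (normr_ge0 t) (normr_ge0 x); lra.
  have [z Jz yz] := Hy (e / K) (divr_gt0 e0 K0).
  have := dJ (z + t *: x); rewrite JD => h.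
  have h1 : `|t * inner (y - z) x| <= `|t| * `|x| * (e / K).
    rewrite normrM -mulrA ler_wpM2l// (le_trans (cauchy_schwarz _ _))//.
    by rewrite mulrC ler_wpM2l// ltW.
  have h2 : e / K + 2 * (`|t| * `|x| * (e / K)) = e.
    by rewrite /K; field; rewrite gt_eqF.
  move: h1; rewrite ler_norml innerBl => /andP[h1 _].
  lra.
exists y => x; rewrite innerC.
have [->|x0] := eqVneq x 0; first by rewrite linear0r; exact: linear0.
apply/esym/eqP; rewrite -(@subr_eq0 R).
have nx : 0 < `|x| ^+ 2 by rewrite exprn_gt0// normr_gt0.
have := key (- ((inner y x - f x) / `|x| ^+ 2)) x.
set a := inner y x - f x; set n := `|x| ^+ 2.
have -> : 2 * - (a / n) * a + (- (a / n)) ^+ 2 * n = - (a ^+ 2 / n).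
  by field; rewrite gt_eqF.
rewrite oppr_ge0 pmulr_lle0 ?invr_gt0// => a2.
by rewrite -sqrf_eq0 eq_le a2 sqr_ge0.
Qed.

End inner_theory.

Section bounded_linear_operator.
Context {R : realType} {H G : hilbertType R}.
Implicit Type L : {linear H -> G}.

Definition opnorm L : R := sup [set `|L x| | x in [set x : H | `|x| <= 1]].

(* By [adjointE] the set below is inhabited when [L] is bounded; the default
   value 0 is used for unbounded [L] only. *)
Definition adjoint L (y : G) : H :=
  xget 0 [set z | forall x, inner (L x) y = inner x z].

Lemma adjointE L : bounded_near L (nbhs (0 : H)) ->
  forall x y, inner (L x) y = inner x (adjoint L y).
Proof.
move=> /linear_boundedP/pinfty_ex_gt0[C C0 LC] x y; move: x.
rewrite /adjoint; case: xgetP => [z _ //|noz]; exfalso.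
pose f (x : H) : R^o := inner (L x) y.
have fl : linear f.
  by move=> a u v; rewrite /f linearP innerDl innerZl.
pose fL : {linear H -> R^o} :=
  HB.pack f (GRing.isLinear.Build _ _ _ _ _ fl).
have [|z fz] := @riesz R H fL; last by apply: (noz z) => x; exact: (fz x).
apply/linear_boundedP; near=> r => x.
apply: (@le_trans _ _ (C * `|y| * `|x|)); last first.
  by rewrite ler_wpM2r//; near: r; apply: nbhs_pinfty_ge; rewrite num_real.
by rewrite (le_trans (cauchy_schwarz _ _))// mulrAC ler_wpM2r.
Unshelve. all: by end_near. Qed.

End bounded_linear_operator.

Section set_valued_operators.
Context {R : realType}.

Definition set_add {V : lmodType R} (A B : V -> set V) : V -> set V :=
  fun x => [set u + v | u in A x & v in B x].

Definition set_sub {V : lmodType R} (A B : V -> set V) : V -> set V :=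
  fun x => [set u - v | u in A x & v in B x].

Definition set_scale {V : lmodType R} (a : R) (A : V -> set V) : V -> set V :=
  fun x => [set a *: u | u in A x].

Definition set_id {V : lmodType R} : V -> set V := fun x => [set x].

Definition set_inv {V W : Type} (A : V -> set W) : W -> set V :=
  fun u => [set x | A x u].

Definition monotone_operator {H : hilbertType R} (A : H -> set H) : Prop :=
  forall x1 x2 u1 u2, A x1 u1 -> A x2 u2 -> 0 <= inner (x1 - x2) (u1 - u2).

Definition parallel_composition {H G : hilbertType R} (L : {linear H -> G})
    (C : G -> set G) : H -> set H :=
  set_inv (fun x => adjoint L @` set_inv C (L x)).

Definition resolvent_composition {H G : hilbertType R} (L : {linear H -> G})
    (gamma : R) (C : G -> set G) : H -> set H :=
  set_sub
    (parallel_composition L (set_add C (set_scale gamma^-1 set_id)))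
    (set_scale gamma^-1 set_id).

End set_valued_operators.

(* Main.v *)
(** Put [k = alpha + 1/gamma >= 0]. A pair in the graph of
    [(L <>_gamma B) - beta Id] has the form [(L^* y, u - k ||L||^-2 L^* y)] with
    [L u - y / gamma \in B y]. For two such pairs, moving [L^*] across the inner
    product and using monotonicity of [B - alpha Id] bounds the inner product of
    the differences below by
    [k (|y1 - y2|^2 - ||L||^-2 |L^* (y1 - y2)|^2)], which is nonnegative since
    [||L^*|| <= ||L||]. *)
Require Import Defs.
From mathcomp Require Import all_boot all_order all_algebra.
From mathcomp Require Import all_classical all_reals all_analysis.
From mathcomp Require Import lra.

Import Order.TTheory GRing.Theory Num.Theory.
Import numFieldNormedType.Exports.

Local Open Scope classical_set_scope.
Local Open Scope ring_scope.

Lemma subrACA (V : zmodType) (x y z t : V) : x - y - (z - t) = x - z - (y - t).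
Proof. by rewrite !opprB addrACA [RHS]addrACA [- y - z]addrC. Qed.

(** Makes the [sup] in [opnorm] a genuine supremum rather than a default value. *)
Lemma has_sup_opnorm (R : realType) (H G : hilbertType R) (L : {linear H -> G}) :
  bounded_near L (nbhs (0 : H)) ->
  has_sup [set `|L x| | x in [set x : H | `|x| <= 1]].
Proof.
move=> /linear_boundedP/pinfty_ex_gt0[C C0 LC]; split.
  by exists `|L 0|, 0 => //=; rewrite normr0 ler01.
exists C => _ [x /= x1 <-]; apply: (le_trans (LC x)).
by rewrite ler_piMr// ltW.
Qed.

Lemma opnorm_ge0 (R : realType) (H G : hilbertType R) (L : {linear H -> G}) :
  bounded_near L (nbhs (0 : H)) -> 0 <= opnorm L.
Proof.
move=> /has_sup_opnorm[_ hub]; apply: (le_trans (normr_ge0 (L 0))).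
by apply: ub_le_sup => //; exists 0 => //=; rewrite normr0 ler01.
Qed.

Lemma le_opnorm (R : realType) (H G : hilbertType R) (L : {linear H -> G}) (x : H) :
  bounded_near L (nbhs (0 : H)) -> `|L x| <= opnorm L * `|x|.
Proof.
move=> /has_sup_opnorm[_ hub].
have [->|x0] := eqVneq x 0; first by rewrite linear0 !normr0 mulr0.
have nx : 0 < `|x| by rewrite normr_gt0.
rewrite -ler_pdivrMr// mulrC.
have -> : `|x|^-1 * `|L x| = `|L (`|x|^-1 *: x)|.
  by rewrite linearZ normrZ ger0_norm// invr_ge0.
apply: ub_le_sup => //; exists (`|x|^-1 *: x) => //=.
by rewrite normrZ ger0_norm ?invr_ge0// mulVf ?gt_eqF.
Qed.

(** With [z] the difference on the left, [|z|^2 = <L z, y1 - y2> <= opnorm L * |z| * |y1 - y2|];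
    divide by [|z|]. Linearity of [adjoint L] is thus never invoked. *)
Lemma norm_adjointB_le (R : realType) (H G : hilbertType R) (L : {linear H -> G})
    (y1 y2 : G) :
  bounded_near L (nbhs (0 : H)) ->
  `|adjoint L y1 - adjoint L y2| <= opnorm L * `|y1 - y2|.
Proof.
move=> bL; set z := adjoint L y1 - adjoint L y2.
have [z0|z0] := eqVneq z 0.
  by rewrite z0 normr0 mulr_ge0// opnorm_ge0.
have nz : 0 < `|z| by rewrite normr_gt0.
rewrite -(ler_pM2l nz) -expr2 -inner_norm {2}/z innerBr -!adjointE// -innerBr.
apply: (le_trans (ler_norm _)); apply: (le_trans (cauchy_schwarz _ _)).
by rewrite mulrA (mulrC `|z|) ler_wpM2r// le_opnorm.
Qed.

Theorem proposition4p1 (R : realType) (H G : hilbertType R)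
    (L : {linear H -> G}) (B : G -> set G) (gamma alpha : R) :
  bounded_near L (nbhs (0 : H)) ->
  (L : H -> G) <> (fun=> 0) ->
  0 < gamma ->
  - 1 / gamma <= alpha ->
  let beta := (alpha + gamma^-1) * opnorm L ^- 2 - gamma^-1 in
  monotone_operator (set_sub B (set_scale alpha set_id)) ->
  monotone_operator
    (set_sub (resolvent_composition L gamma B) (set_scale beta set_id)).
Proof.
move=> bL _ gamma0 alpha_ge beta monB x1 x2 w1 w2.
(* Unfolding both inverses gives [adjoint L y1 = x1] and [b1 + gamma^-1 *: y1 = L u1] with [b1] in
   [B y1]. *)
case=> _ [u1 [y1 [b1 Bb1 [_ [_ -> <-] Lu1]] adj1] [_ [_ -> <-] <-]].
case=> _ [_ -> <-] <-.
case=> _ [u2 [y2 [b2 Bb2 [_ [_ -> <-] Lu2]] adj2] [_ [_ -> <-] <-]].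
case=> _ [_ -> <-] <-.
have k0 : 0 <= alpha + gamma^-1 by move: alpha_ge; rewrite mulN1r; lra.
have monb : alpha * `|y1 - y2| ^+ 2 <= inner (y1 - y2) (b1 - b2).
  have := monB y1 y2 (b1 - alpha *: y1) (b2 - alpha *: y2).
  have -> : b1 - alpha *: y1 - (b2 - alpha *: y2) =
      (b1 - b2) - alpha *: (y1 - y2).
    by rewrite subrACA -scalerBr.
  rewrite innerBr innerZr inner_norm subr_ge0; apply.
    by exists b1 => //; exists (alpha *: y1) => //; exists y1.
  by exists b2 => //; exists (alpha *: y2) => //; exists y2.
have adjoint_le : opnorm L ^- 2 * `|x1 - x2| ^+ 2 <= `|y1 - y2| ^+ 2.
  have := norm_adjointB_le _ _ _ L y1 y2 bL; rewrite adj1 adj2 => le_x.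
  (* As [0^-1 = 0], the left-hand side vanishes when [opnorm L = 0]. *)
  have [L0|L0] := eqVneq (opnorm L) 0.
    by rewrite L0 expr0n/= invr0 mul0r exprn_ge0.
  have Lgt0 : 0 < opnorm L by rewrite lt_def L0 opnorm_ge0.
  rewrite mulrC ler_pdivrMr ?exprn_gt0// mulrC -exprMn.
  by rewrite ler_sqr ?nnegrE// mulr_ge0// ltW.
(* Write [x1], [x2] as adjoint values, move [L] onto [u1 - u2], then substitute [Lu1] and [Lu2]. *)
have inner_xu : inner (x1 - x2) (u1 - u2) =
    inner (y1 - y2) (b1 - b2) + gamma^-1 * `|y1 - y2| ^+ 2.
  rewrite innerC -adj1 -adj2 innerBr -!adjointE// -innerBr innerC linearB.
  by rewrite -Lu1 -Lu2 opprD addrACA -scalerBr innerDr innerZr inner_norm.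
(* The term [- gamma^-1] in [beta] cancels the one from the resolvent composition. *)
have -> : u1 - gamma^-1 *: x1 - beta *: x1 - (u2 - gamma^-1 *: x2 - beta *: x2) =
    (u1 - u2) - ((alpha + gamma^-1) * opnorm L ^- 2) *: (x1 - x2).
  rewrite subrACA (subrACA _ u1) -!scalerBr -addrA -opprD -scalerDl.
  by rewrite [gamma^-1 + _]addrC subrK.
rewrite innerBr innerZr inner_norm inner_xu -mulrA.
(* Add [monb] to [adjoint_le] scaled by [alpha + gamma^-1]. *)
have := ler_wpM2l k0 adjoint_le; lra.
Qed.
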